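(* Let $d\ge2$, $m\ge0$ and $L\ge1$. Define $a_m^{(d)}(n)=\bigl(\sum_{p\ge0,\ p\,\&\,m=0}\delta_p(n)\bigr)\bmod d$, let $M=2^{K(m)}L$ and $N=d^M$. Then for all $j_1,j_2\in\{0,\dots,d-1\}$ and $k=0,\dots,s_mL-1$, \[ \sum_{\substack{0\le n<N\\ a_m^{(d)}(n)=j_1}}n^k=\sum_{\substack{0\le n<N\\ a_m^{(d)}(n)=j_2}}n^k. \]
   Context: For $n\ge0$, $n=\sum_{p\ge0}\delta_p(n)d^p$ with $\delta_p(n)\in\{0,\dots,d-1\}$ is its base-$d$ expansion. The condition $p\,\&\,m=0$ uses the bitwise AND of the binary expansions of $p$ and $m$. $K(m)=\max(1,\lceil\log_2(m+1)\rceil)$ and $s_m=|\{p\in[0,2^{K(m)}):p\,\&\,m=0\}|$. *)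

(* Defs.v *)
From mathcomp Require Import all_boot.

Set Implicit Arguments.
Unset Strict Implicit.
Unset Printing Implicit Defensive.

Definition digit (d p n : nat) : nat := (n %/ d ^ p) %% d.

Lemma digit_lt d p n : 1 < d -> digit d p n < d.
Proof. by move=> d_gt1; rewrite ltn_mod ltnW. Qed.

Lemma digit_expansion_mod d n B :
  n %% d ^ B = \sum_(p < B) digit d p n * d ^ p.
Proof.
elim: B => [|B IH]; first by rewrite big_ord0 modn1.
rewrite big_ord_recr /= -IH /digit modn_divl -expnS addnC.
by rewrite {1}(divn_eq (n %% d ^ B.+1) (d ^ B)) modn_dvdm // expnS dvdn_mull.
Qed.

Lemma digit_expansion d n B :
  1 < d -> n <= B -> n = \sum_(p < B) digit d p n * d ^ p.
Proof.
move=> d_gt1 le_nB; rewrite -digit_expansion_mod modn_small //.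
exact: leq_ltn_trans le_nB (ltn_expl B d_gt1).
Qed.

Lemma digit_big d p n : 1 < d -> n <= p -> digit d p n = 0.
Proof.
move=> d_gt1 le_np; rewrite /digit divn_small ?mod0n //.
exact: leq_ltn_trans le_np (ltn_expl p d_gt1).
Qed.

(* [Nat.land] is the bitwise AND. For d >= 2 every digit of n at a position
   p >= n is 0 (n < d ^ n), so the sum over all p >= 0 is the sum over p < n;
   [a_widen] shows that any larger cutoff gives the same value. *)
Definition a (d m n : nat) : nat :=
  (\sum_(p < n | Nat.land p m == 0) digit d p n) %% d.

Lemma a_widen d m n B : 1 < d -> n <= B ->
  a d m n = (\sum_(p < B | Nat.land p m == 0) digit d p n) %% d.
Proof.
move=> d_gt1 le_nB; congr (_ %% d).
rewrite -(big_mkord (fun p => Nat.land p m == 0) (fun p => digit d p n)).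
rewrite -(big_mkord (fun p => Nat.land p m == 0) (fun p => digit d p n)).
rewrite (big_cat_nat (n := n) (p := B)) //=.
rewrite [X in _ = _ + X]big_nat_cond [X in _ = _ + X]big1 ?addn0 // => p.
by case/andP=> /andP[le_np _] _; apply: digit_big.
Qed.

(* [up_log 2 x] is the least e with x <= 2 ^ e, i.e. the ceiling of log_2 x
   for x >= 1. *)
Definition K (m : nat) : nat := maxn 1 (up_log 2 m.+1).

Definition s (m : nat) : nat := #|[set p : 'I_(2 ^ K m) | Nat.land p m == 0]|.

(* Main.v *)
Require Import Defs.
From Stdlib Require Import PeanoNat.
From mathcomp Require Import all_boot.

(** Fix any set [P] of digit positions and let [c] be the number of its elements
    below [B].  The power sums of order [k < c] over the [n < d ^ B] with a
    prescribed [P]-digit sum modulo [d] do not depend on the prescribed value.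
    By induction on [B]: write [n = e * d ^ B + n'] and expand [n ^ k]
    binomially.  The coefficients of [n' ^ i] with [i < c] are covered by the
    induction hypothesis; if [B] is in [P], the new power [i = c] can only occur as
    [i = k], where the weight of [e] is trivial, so summing over all [e] sums over
    all residues.
    For the theorem, [p & m] only depends on [p %% 2 ^ K m], so each of the [L]
    blocks of [2 ^ K m] positions contains [s m] positions of [P]. *)

Lemma big_nat_blocks (F : nat -> nat) (r q : nat) :
  \sum_(n < r * q) F n = \sum_(e < r) \sum_(n < q) F (e * q + n).
Proof.
elim: r => [|r IH]; first by rewrite mul0n !big_ord0.
rewrite big_ord_recr /= -IH -!(big_mkord xpredT) mulSn addnC.
rewrite (big_cat_nat (n := r * q)) ?leq_addr //=; congr (_ + _).
rewrite -{1}[r * q]add0n big_addn addKn.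
by rewrite -[RHS](big_mkord xpredT (fun n => F (r * q + n))); apply: eq_bigr => n _; rewrite addnC.
Qed.

(** Sliding the window by one drops the term of [z] and gains that of [z + d], which is equal modulo
    [d]. Adding the term of [z] to both sides gives the same sum over [d.+1] values. *)
Lemma sum_dvdn_shift (d z : nat) :
  \sum_(e < d) (d %| z + e) = \sum_(e < d) (d %| e).
Proof.
elim: z => [|z IH] //; rewrite -IH.
apply/eqP; rewrite -(eqn_add2l (d %| z)); apply/eqP.
transitivity (\sum_(e < d.+1) (d %| z + e)).
  rewrite big_ord_recl addn0; congr (_ + _).
  by apply: eq_bigr => e _; rewrite /bump /= addSnnS.
by rewrite big_ord_recr /= dvdn_addl // addnC.
Qed.

Section DigitSums.
Variables (d : nat) (P : pred nat).
Hypothesis d_gt1 : 1 < d.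

Definition digit_sum (B n : nat) : nat := \sum_(p < B | P p) digit d p n.

Lemma digit_block_lt (B e n p : nat) : p < B ->
  digit d p (e * d ^ B + n) = digit d p n.
Proof.
(* Digit [p] depends only on the number modulo [d ^ p.+1], which divides [d ^ B]. *)
move=> ltpB; rewrite /digit !modn_divl -expnS; congr (_ %/ _).
by rewrite -modnDml (eqP (dvdn_mull e (dvdn_exp2l d ltpB))) add0n.
Qed.

Lemma digit_block_eq (B e n : nat) : e < d -> n < d ^ B ->
  digit d B (e * d ^ B + n) = e.
Proof.
move=> lted ltn; rewrite /digit divnMDl ?expn_gt0 ?(ltnW d_gt1) //.
by rewrite divn_small // addn0 modn_small.
Qed.

Lemma digit_sum_block (B e n : nat) : e < d -> n < d ^ B ->
  digit_sum B.+1 (e * d ^ B + n) = digit_sum B n + P B * e.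
Proof.
move=> lted ltn; rewrite /digit_sum [LHS]big_mkcond [in RHS]big_mkcond /=.
rewrite big_ord_recr /= digit_block_eq //; congr (_ + _); last by case: (P B); rewrite ?mul1n.
by apply: eq_bigr => p _; rewrite digit_block_lt.
Qed.

Lemma power_sum_block (B x k : nat) :
  \sum_(n < d ^ B.+1 | d %| digit_sum B.+1 n + x) n ^ k =
  \sum_(i < k.+1) \sum_(e < d) 'C(k, i) * (e * d ^ B) ^ (k - i) *
    \sum_(n < d ^ B | d %| digit_sum B n + (P B * e + x)) n ^ i.
Proof.
rewrite big_mkcond expnS.
rewrite (big_nat_blocks (fun n => if d %| digit_sum B.+1 n + x then n ^ k else 0)).
rewrite [RHS]exchange_big; apply: eq_bigr => e _ /=.
under [RHS]eq_bigr => i _ do rewrite big_distrr /=.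
rewrite exchange_big [RHS]big_mkcond; apply: eq_bigr => n _ /=.
rewrite digit_sum_block // addnA; case: ifP => // _.
by rewrite expnDn; apply: eq_bigr => i _; rewrite mulnA.
Qed.

(** With the sums exchanged, each [n] is counted once per [e] in a full period that hits the
    residue, a count independent of [x]. *)
Lemma power_sum_all_residues (B x k : nat) :
  \sum_(e < d) \sum_(n < d ^ B | d %| digit_sum B n + (e + x)) n ^ k =
  \sum_(n < d ^ B) n ^ k * \sum_(e < d) (d %| e).
Proof.
under eq_bigr => e _ do rewrite big_mkcond.
rewrite exchange_big; apply: eq_bigr => n _ /=.
rewrite -(sum_dvdn_shift d (digit_sum B n + x)) big_distrr /=.
apply: eq_bigr => e _; rewrite addnAC -addnA.
by case: (d %| _); rewrite ?muln1 ?muln0.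
Qed.

(** Both offsets stay general: the induction hypothesis is applied at [P B * e + x] and
    [P B * e + y]. *)
Lemma power_sum_const (B x y k : nat) : k < \sum_(p < B) P p ->
  \sum_(n < d ^ B | d %| digit_sum B n + x) n ^ k =
  \sum_(n < d ^ B | d %| digit_sum B n + y) n ^ k.
Proof.
elim: B x y k => [|B IH] x y k; first by rewrite big_ord0.
rewrite big_ord_recr /= => ltk; rewrite !power_sum_block.
apply: eq_bigr => i _.
have [lti | lei] := ltnP i (\sum_(p < B) P p).
  by apply: eq_bigr => e _; rewrite (IH _ (P B * e + y)).
(* With c the count below [B], c <= i <= k < c + [P B] forces [P B] to be 1 and i = k = c. *)
have le_ik : i <= k by rewrite -ltnS.
have PB : P B by move: ltk; case: (P B) => //; rewrite addn0 ltnNge (leq_trans lei).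
have -> : i = k :> nat.
  apply/eqP; rewrite eqn_leq le_ik /=.
  by apply: leq_trans lei; move: ltk; rewrite PB addn1 ltnS.
under eq_bigr => e _ do rewrite subnn binn !mul1n PB mul1n.
under [RHS]eq_bigr => e _ do rewrite subnn binn !mul1n PB mul1n.
by rewrite !power_sum_all_residues.
Qed.

End DigitSums.

Lemma Nat_pow_expn (b e : nat) : Nat.pow b e = b ^ e.
Proof. by elim: e => [|e IH] //=; rewrite IH expnS multE. Qed.

Lemma Nat_modulo_modn (n q : nat) : 0 < q -> Nat.modulo n q = n %% q.
Proof.
move=> q_gt0; apply/esym/(Nat.mod_unique _ _ (n %/ q)).
  by apply/ltP; rewrite ltn_mod.
by rewrite multE plusE mulnC -divn_eq.
Qed.

(** Reduction modulo [2 ^ e] is the AND with [Nat.ones e]; associativity moves this mask from [p] to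
    [m], which it leaves unchanged. *)
Lemma land_modn_exp2 (p m e : nat) : m < 2 ^ e ->
  Nat.land (p %% 2 ^ e) m = Nat.land p m.
Proof.
have landE x : Nat.land x (Nat.ones e) = x %% 2 ^ e.
  by rewrite Nat.land_ones Nat_pow_expn Nat_modulo_modn ?expn_gt0.
move=> ltm; rewrite -landE -Nat.land_assoc (Nat.land_comm _ m) landE.
by rewrite modn_small.
Qed.

Lemma ltn_exp2_K (m : nat) : m < 2 ^ K m.
Proof.
apply: (@leq_trans (2 ^ up_log 2 m.+1)); first exact: up_logP.
by rewrite leq_exp2l // leq_maxr.
Qed.

Lemma count_positions (m L : nat) :
  \sum_(p < 2 ^ K m * L) (Nat.land p m == 0) = s m * L.
Proof.
rewrite mulnC (big_nat_blocks (fun p => Nat.land p m == 0 : nat)).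
rewrite [RHS]mulnC -[L in RHS]card_ord -sum_nat_const.
apply: eq_bigr => e _; rewrite /s -sum1_card [RHS]big_mkcond /=.
apply: eq_bigr => p _; rewrite inE -(land_modn_exp2 _ _ _ (ltn_exp2_K m)).
by rewrite modnMDl modn_small //; case: eqP.
Qed.

Lemma eqn_mod_dvdn_addB (d z j : nat) : j < d ->
  (z %% d == j) = (d %| z + (d - j)).
Proof.
(* As [j < d], the natural number [d - j] represents -j modulo [d]. *)
move=> ltjd; rewrite -[j in LHS](modn_small ltjd) -(eqn_modDr (d - j)).
by rewrite subnKC ?modnn // ltnW.
Qed.

Lemma a_digit_sum (d m B n : nat) : 1 < d -> n < d ^ B ->
  a d m n = digit_sum d (fun p => Nat.land p m == 0) B n %% d.
Proof.
(* Neither of [n] and [B] need bound the other, so both sums are compared at the cutoff [maxn n B];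
   digits from [B] on vanish. *)
move=> d_gt1 ltn; rewrite (@a_widen _ _ _ (maxn n B)) ?leq_maxl //.
congr (_ %% d); rewrite /digit_sum.
rewrite (big_ord_widen_cond _ (fun p => Nat.land p m == 0) (fun p => digit d p n) (leq_maxr n B)).
rewrite big_mkcond [RHS]big_mkcond /=.
apply: eq_bigr => p _; case: (ltnP p B) => [_|lep]; first by rewrite andbT.
rewrite andbF /digit divn_small ?mod0n ?if_same //.
by apply: leq_trans ltn _; rewrite leq_exp2l.
Qed.

Theorem theorem58 (d m L : nat) (hd : 2 <= d) (hL : 1 <= L) :
  let M := 2 ^ K m * L in
  let N := d ^ M in
  forall j1 j2 : 'I_d, forall k : nat, k < s m * L ->
    \sum_(0 <= n < N | a d m n == j1) n ^ k =
    \sum_(0 <= n < N | a d m n == j2) n ^ k.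
Proof.
move=> M N j1 j2 k; rewrite -count_positions => ltk.
have shiftE (j : 'I_d) : \sum_(0 <= n < N | a d m n == j) n ^ k =
    \sum_(n < N | d %| digit_sum d (fun p => Nat.land p m == 0) M n + (d - j)) n ^ k.
  by rewrite big_mkord; apply: eq_bigl => n; rewrite (a_digit_sum _ _ M) // eqn_mod_dvdn_addB.
by rewrite !shiftE; apply: power_sum_const.
Qed.
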